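(* Let $q$ be a real number with $0<q<1$. (1) For all integers $n\ge1$, $\mathcal O(S^{2n+1}_q)\square_{\mathcal O(\mathbb Z_2)}\mathcal O(U(1))$ is an algebra isomorphic to $\mathcal O(S^{2n+1}_q)\otimes\mathcal O(U(1))$. (2) For all integers $n>1$, $\mathcal O(S^{2n}_q)\square_{\mathcal O(\mathbb Z_2)}\mathcal O(U(1))$ is a subalgebra of $\mathcal O(S^{2n}_q)\otimes\mathcal O(U(1))$ isomorphic to the $*$-algebra $\mathcal A^{2n}$ generated by $\zeta_0,\zeta_1,\dots,\zeta_n$ and a central unitary $\xi$ subject to the relations $$\zeta_i\zeta_j=q\zeta_j\zeta_i\ \text{ for } i<j,\qquad \zeta_i\zeta_j^*=q\zeta_j^*\zeta_i\ \text{ for } i\ne j,$$ $$\zeta_i\zeta_i^*=\zeta_i^*\zeta_i+(q^{-2}-1)\sum_{m=i+1}^n\zeta_m\zeta_m^*,\qquad \sum_{m=0}^n\zeta_m\zeta_m^*=1,\qquad \zeta_n^*=\zeta_n\xi.$$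
   Context: All algebras are associative unital over $\mathbb C$. The coordinate algebra $\mathcal O(S^{2n+1}_q)$ is the unital complex $*$-algebra with generators $z_0,\dots,z_n$ and relations $$z_iz_j=qz_jz_i\ (i<j),\quad z_iz_j^*=qz_j^*z_i\ (i\ne j),\quad z_iz_i^*=z_i^*z_i+(q^{-2}-1)\sum_{m=i+1}^nz_mz_m^*,\quad \sum_{m=0}^nz_mz_m^*=1.$$ $\mathcal O(S^{2n}_q)$ is the unital complex $*$-algebra with generators $z_0,\dots,z_n$, the same relations, and additionally $z_n^*=z_n$. $\mathcal O(\mathbb Z_2)$ is the Hopf $*$-algebra generated by a self-adjoint grouplike $u$ with $u^2=1$. $\mathcal O(U(1))=\mathbb C[v,v^{-1}]$ is the Hopf $*$-algebra of Laurent polynomials with $v$ unitary ($v^*=v^{-1}$) and grouplike. $\pi_2:\mathcal O(U(1))\to\mathcal O(\mathbb Z_2)$, $v\mapsto u$, is a Hopf algebra map. Each $\mathcal O(S^m_q)$ is a right $\mathcal O(\mathbb Z_2)$-comodule algebra with coaction the $*$-algebra map determined by $z_i\mapsto z_i\otimes u$. The prolongation (along $\pi_2$) is the cotensor product $\mathcal O(S^m_q)\square_{\mathcal O(\mathbb Z_2)}\mathcal O(U(1))=\{\sum_ia^i\otimes h^i\in\mathcal O(S^m_q)\otimes\mathcal O(U(1))\mid\sum_ia^i_{(0)}\otimes a^i_{(1)}\otimes h^i=\sum_ia^i\otimes\pi_2(h^i_{(1)})\otimes h^i_{(2)}\}$, a $*$-subalgebra of the tensor product algebra; here $a\mapsto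 a_{(0)}\otimes a_{(1)}$ is the coaction and $h\mapsto h_{(1)}\otimes h_{(2)}$ the comultiplication. *)

(* Defs.v *)
From HB Require Import structures.
From mathcomp Require Import all_boot all_order all_algebra.
From mathcomp Require Import boolp classical_sets reals.
From mathcomp Require Export complex.

Set Implicit Arguments.
Unset Strict Implicit.
Unset Printing Implicit Defensive.

Import GRing.Theory Num.Theory.

Declare Scope sterm_scope.
Delimit Scope sterm_scope with ST.
Local Open Scope ring_scope.
Local Open Scope quotient_scope.
Local Open Scope classical_set_scope.

(** * Unital *-algebras over a closed field with conjugation

    A C-algebra is a ring with a central ring morphism [a |-> a%:S] from C, so
    that scaling by a is multiplication by a%:S. The library's [algType] is not
    used because it excludes the zero ring, which a presentation may define. *)

HB.mixin Record isStarAlgebra (C : numClosedFieldType) A of GRing.PzRing A := {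
  scst : C -> A;
  scst1 : scst 1 = 1;
  scstD : {morph scst : a b / a + b};
  scstM : {morph scst : a b / a * b};
  scstC : forall a x, scst a * x = x * scst a;
  star : A -> A;
  starK : involutive star;
  starD : {morph star : x y / x + y};
  starM : forall x y, star (x * y) = star y * star x;
  star_scst : forall a, star (scst a) = scst a^*
}.

#[short(type="starAlgType")]
HB.structure Definition StarAlgebra (C : numClosedFieldType) :=
  {A of isStarAlgebra C A & GRing.PzRing A}.

Notation "a %:S" := (scst a) (at level 1, left associativity, format "a %:S")
  : ring_scope.

Section StarAlgebraTheory.
Variables (C : numClosedFieldType) (A : starAlgType C).

Lemma scst0 : 0%:S = 0 :> A.
Proof. by apply: (addIr (0%:S : A)); rewrite -scstD !add0r. Qed.

Lemma scstCA (a : C) (x y : A) : x * (a%:S * y) = a%:S * (x * y).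
Proof. by rewrite mulrA -scstC mulrA. Qed.

End StarAlgebraTheory.

Definition star_hom (C : numClosedFieldType) (A B : starAlgType C)
    (f : A -> B) : Prop :=
  [/\ {morph f : x y / x + y}, {morph f : x y / x * y},
      forall a : C, f a%:S = a%:S & {morph f : x / star x}].

(* Containing the scalars and being closed under products gives the unit and
   closure under scaling. *)
Definition star_subalgebra (C : numClosedFieldType) (A : starAlgType C)
    (S : set A) : Prop :=
  [/\ forall a : C, S a%:S, forall x y, S x -> S y -> S (x + y),
      forall x y, S x -> S y -> S (x * y) & forall x, S x -> S (star x)].

(* The *-subalgebra S of A, with the structure inherited from A, is isomorphic
   to B as a *-algebra. *)
Definition star_isomorphic (C : numClosedFieldType) (A : starAlgType C)
    (S : set A) (B : starAlgType C) : Prop :=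
  exists f : B -> A, [/\ star_hom f, injective f & range f = S].

(** * *-algebras given by generators and relations *)

Inductive sterm (C X : Type) :=
  | Gen of X
  | Cst of C
  | Add of sterm C X & sterm C X
  | Mul of sterm C X & sterm C X
  | Star of sterm C X.

Arguments Gen {C X} x.
Arguments Cst {C X} a.
Arguments Add {C X} s t.
Arguments Mul {C X} s t.
Arguments Star {C X} t.
Bind Scope sterm_scope with sterm.

Infix "+" := Add : sterm_scope.
Infix "*" := Mul : sterm_scope.
Notation "t ^*" := (Star t) : sterm_scope.

HB.instance Definition _ (C X : Type) := gen_eqMixin (sterm C X).
HB.instance Definition _ (C X : Type) := gen_choiceMixin (sterm C X).

Section Presented.
Variables (C : numClosedFieldType) (X : Type).
Local Notation T := (sterm C X).

(* The least congruence containing R and the axioms of unital *-algebras;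
   Cst embeds the scalars. *)
Inductive scong (R : T -> T -> Prop) : T -> T -> Prop :=
  | sc_rel s t : R s t -> scong R s t
  | sc_refl t : scong R t t
  | sc_sym s t : scong R s t -> scong R t s
  | sc_trans s t u : scong R s t -> scong R t u -> scong R s u
  | sc_add s s' t t' : scong R s s' -> scong R t t' ->
      scong R (s + t)%ST (s' + t')%ST
  | sc_mul s s' t t' : scong R s s' -> scong R t t' ->
      scong R (s * t)%ST (s' * t')%ST
  | sc_star t t' : scong R t t' -> scong R (t^*)%ST (t'^*)%ST
  | sc_cstD a b : scong R (Cst (a + b)) (Cst a + Cst b)%ST
  | sc_cstM a b : scong R (Cst (a * b)) (Cst a * Cst b)%ST
  | sc_cst_star a : scong R ((Cst a)^*)%ST (Cst a^*)
  | sc_cstC a t : scong R (Cst a * t)%ST (t * Cst a)%ST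
  | sc_addA s t u : scong R (s + (t + u))%ST ((s + t) + u)%ST
  | sc_addC s t : scong R (s + t)%ST (t + s)%ST
  | sc_add0 t : scong R (Cst 0 + t)%ST t
  | sc_mulA s t u : scong R (s * (t * u))%ST ((s * t) * u)%ST
  | sc_mul1 t : scong R (Cst 1 * t)%ST t
  | sc_mul0 t : scong R (Cst 0 * t)%ST (Cst 0)
  | sc_mulDl s t u : scong R ((s + t) * u)%ST (s * u + t * u)%ST
  | sc_mulDr s t u : scong R (u * (s + t))%ST (u * s + u * t)%ST
  | sc_starK t : scong R ((t^*)^*)%ST t
  | sc_starD s t : scong R ((s + t)^*)%ST (s^* + t^*)%ST
  | sc_starM s t : scong R ((s * t)^*)%ST (t^* * s^*)%ST.

Variable R : T -> T -> Prop.

Definition scongb (s t : T) : bool := `[< scong R s t >].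

Lemma scongb_refl : reflexive scongb.
Proof. by move=> t; apply/asboolP; exact: sc_refl. Qed.

Lemma scongb_sym : symmetric scongb.
Proof. by move=> s t; apply/asboolP/asboolP; exact: sc_sym. Qed.

Lemma scongb_trans : transitive scongb.
Proof.
by move=> t s u /asboolP st /asboolP tu; apply/asboolP; exact: sc_trans st tu.
Qed.

Canonical scong_equiv := EquivRel scongb scongb_refl scongb_sym scongb_trans.

Definition presented := {eq_quot scong_equiv}.
HB.instance Definition _ := Choice.on presented.

Definition pcls (t : T) : presented := \pi_(presented) t.
Definition prep (x : presented) : T := repr x.

Lemma prepK x : pcls (prep x) = x. Proof. exact: reprK. Qed.

Lemma pclsP s t : scong R s t <-> pcls s = pcls t.
Proof.
split=> [st|/eqmodP/asboolP //].
by apply/eqmodP; apply/asboolP.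
Qed.

Lemma prep_cong t : scong R (prep (pcls t)) t.
Proof. by apply/pclsP; rewrite prepK. Qed.

Lemma pcls_ind (P : presented -> Prop) : (forall t, P (pcls t)) -> forall x, P x.
Proof. by move=> Pt x; rewrite -(prepK x). Qed.

Definition padd x y := pcls (prep x + prep y)%ST.
Definition pmul x y := pcls (prep x * prep y)%ST.
Definition pstar x := pcls ((prep x)^*)%ST.
Definition popp x := pcls (Cst (-1) * prep x)%ST.

Lemma paddE s t : padd (pcls s) (pcls t) = pcls (s + t)%ST.
Proof. by apply/pclsP; apply: sc_add; exact: prep_cong. Qed.

Lemma pmulE s t : pmul (pcls s) (pcls t) = pcls (s * t)%ST.
Proof. by apply/pclsP; apply: sc_mul; exact: prep_cong. Qed.

Lemma pstarE t : pstar (pcls t) = pcls (t^*)%ST.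
Proof. by apply/pclsP; apply: sc_star; exact: prep_cong. Qed.

Let pE := (paddE, pmulE, pstarE).

Lemma paddA : associative padd.
Proof.
elim/pcls_ind=> s; elim/pcls_ind=> t; elim/pcls_ind=> u.
by rewrite !pE; apply/pclsP; exact: sc_addA.
Qed.

Lemma paddC : commutative padd.
Proof.
by elim/pcls_ind=> s; elim/pcls_ind=> t; rewrite !pE; apply/pclsP; exact: sc_addC.
Qed.

Lemma padd0 : left_id (pcls (Cst 0)) padd.
Proof. by elim/pcls_ind=> s; rewrite !pE; apply/pclsP; exact: sc_add0. Qed.

Lemma paddN : left_inverse (pcls (Cst 0)) popp padd.
Proof.
elim/pcls_ind=> t; apply/pclsP.
apply: sc_trans (sc_add (prep_cong _) (prep_cong _)) _.
apply: (@sc_trans _ _ (Cst (-1) * t + t)%ST).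
  apply: sc_add; last exact: sc_refl.
  by apply: sc_mul; [exact: sc_refl | exact: prep_cong].
apply: (@sc_trans _ _ (Cst (-1) * t + Cst 1 * t)%ST).
  by apply: sc_add; [exact: sc_refl | apply: sc_sym; exact: sc_mul1].
apply: sc_trans (sc_sym (sc_mulDl _ _ _ _)) _.
apply: (@sc_trans _ _ (Cst 0 * t)%ST); last exact: sc_mul0.
by apply: sc_mul; [rewrite -(addNr 1); apply: sc_sym; exact: sc_cstD | exact: sc_refl].
Qed.

HB.instance Definition _ :=
  GRing.isZmodule.Build presented paddA paddC padd0 paddN.

Lemma pmulA : associative pmul.
Proof.
elim/pcls_ind=> s; elim/pcls_ind=> t; elim/pcls_ind=> u.
by rewrite !pE; apply/pclsP; exact: sc_mulA.
Qed.

Lemma pmul1 : left_id (pcls (Cst 1)) pmul.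
Proof. by elim/pcls_ind=> s; rewrite !pE; apply/pclsP; exact: sc_mul1. Qed.

Lemma pmulr1 : right_id (pcls (Cst 1)) pmul.
Proof.
elim/pcls_ind=> s; rewrite !pE; apply/pclsP.
by apply: sc_trans (sc_sym (sc_cstC _ _ _)) _; exact: sc_mul1.
Qed.

Lemma pmulDl : left_distributive pmul +%R.
Proof.
elim/pcls_ind=> s; elim/pcls_ind=> t; elim/pcls_ind=> u.
by rewrite /GRing.add /= !pE; apply/pclsP; exact: sc_mulDl.
Qed.

Lemma pmulDr : right_distributive pmul +%R.
Proof.
elim/pcls_ind=> s; elim/pcls_ind=> t; elim/pcls_ind=> u.
by rewrite /GRing.add /= !pE; apply/pclsP; exact: sc_mulDr.
Qed.

HB.instance Definition _ :=
  GRing.Zmodule_isPzRing.Build presented pmulA pmul1 pmulr1 pmulDl pmulDr.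

Definition pcst (a : C) : presented := pcls (Cst a).

Lemma pcst1 : pcst 1 = 1. Proof. by []. Qed.

Lemma pcstD : {morph pcst : a b / a + b}.
Proof. by move=> a b; rewrite [RHS]paddE; apply/pclsP; exact: sc_cstD. Qed.

Lemma pcstM : {morph pcst : a b / a * b}.
Proof. by move=> a b; rewrite [RHS]pmulE; apply/pclsP; exact: sc_cstM. Qed.

Lemma pcstC a (x : presented) : pcst a * x = x * pcst a.
Proof.
elim/pcls_ind: x => t; rewrite [LHS]pmulE [RHS]pmulE; apply/pclsP.
exact: sc_cstC.
Qed.

Lemma pstarK : involutive pstar.
Proof. by elim/pcls_ind=> s; rewrite !pE; apply/pclsP; exact: sc_starK. Qed.

Lemma pstarD : {morph pstar : x y / x + y}.
Proof.
elim/pcls_ind=> s; elim/pcls_ind=> t.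
by rewrite /GRing.add /= !pE; apply/pclsP; exact: sc_starD.
Qed.

Lemma pstarM (x y : presented) : pstar (x * y) = pstar y * pstar x.
Proof.
elim/pcls_ind: x => s; elim/pcls_ind: y => t.
by rewrite /GRing.mul /= !pE; apply/pclsP; exact: sc_starM.
Qed.

Lemma pstar_cst a : pstar (pcst a) = pcst a^*.
Proof. by rewrite pstarE; apply/pclsP; exact: sc_cst_star. Qed.

HB.instance Definition _ := isStarAlgebra.Build C presented
  pcst1 pcstD pcstM pcstC pstarK pstarD pstarM pstar_cst.

Definition pgen (x : X) : presented := pcls (Gen x).

End Presented.

Section PresentedLift.
Variables (C : numClosedFieldType) (X : Type) (R : sterm C X -> sterm C X -> Prop).
Variables (A : starAlgType C) (f : X -> A).

Fixpoint seval (t : sterm C X) : A :=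
  match t with
  | Gen x => f x
  | Cst a => a%:S
  | Add s t => seval s + seval t
  | Mul s t => seval s * seval t
  | Star t => star (seval t)
  end.

(* The *-homomorphism determined by f; meaningful when f satisfies the
   relations, see [plift_hom]. *)
Definition plift (x : presented R) : A := seval (prep x).

Hypothesis fR : forall s t, R s t -> seval s = seval t.

Lemma seval_cong s t : scong R s t -> seval s = seval t.
Proof.
elim=> {s t} /=.
- exact: fR.
- by [].
- by [].
- by move=> s t u _ -> _ ->.
- by move=> s s' t t' _ -> _ ->.
- by move=> s s' t t' _ -> _ ->.
- by move=> t t' _ ->.
- by move=> a b; rewrite scstD.
- by move=> a b; rewrite scstM.
- by move=> a; rewrite star_scst.
- by move=> a t; rewrite scstC.
- by move=> s t u; rewrite addrA.
- by move=> s t; rewrite addrC.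
- by move=> t; rewrite scst0 add0r.
- by move=> s t u; rewrite mulrA.
- by move=> t; rewrite scst1 mul1r.
- by move=> t; rewrite scst0 mul0r.
- by move=> s t u; rewrite mulrDl.
- by move=> s t u; rewrite mulrDr.
- by move=> t; rewrite starK.
- by move=> s t; rewrite starD.
- by move=> s t; rewrite starM.
Qed.

Lemma plift_cls t : plift (pcls R t) = seval t.
Proof. by apply: seval_cong; exact: prep_cong. Qed.

Lemma plift_gen x : plift (pgen R x) = f x.
Proof. by rewrite plift_cls. Qed.

Lemma plift_hom : star_hom plift.
Proof.
split.
- elim/pcls_ind=> s; elim/pcls_ind=> t.
  by rewrite [in LHS]/GRing.add /= paddE !plift_cls.
- elim/pcls_ind=> s; elim/pcls_ind=> t.
  by rewrite [in LHS]/GRing.mul /= pmulE !plift_cls.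
- by move=> a; rewrite [LHS]plift_cls.
- by elim/pcls_ind=> t; rewrite [in LHS]/star /= pstarE !plift_cls.
Qed.

End PresentedLift.

(** * Tensor products over C *)

Section Tensor.
Variables (C : numClosedFieldType) (A B : starAlgType C).

(* A list of pairs stands for the sum of the corresponding pure tensors. *)
Inductive tcong : seq (A * B) -> seq (A * B) -> Prop :=
  | tc_refl s : tcong s s
  | tc_sym s t : tcong s t -> tcong t s
  | tc_trans s t r : tcong s t -> tcong t r -> tcong s r
  | tc_cat s s' t t' : tcong s s' -> tcong t t' -> tcong (s ++ t) (s' ++ t')
  | tc_catC s t : tcong (s ++ t) (t ++ s)
  | tc_addl a a' b : tcong [:: (a + a', b)] [:: (a, b); (a', b)]
  | tc_addr a b b' : tcong [:: (a, b + b')] [:: (a, b); (a, b')]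
  | tc_scale c a b : tcong [:: (c%:S * a, b)] [:: (a, c%:S * b)]
  | tc_zero b : tcong [:: (0, b)] [::].

Definition tcongb s t : bool := `[< tcong s t >].

Lemma tcongb_refl : reflexive tcongb.
Proof. by move=> t; apply/asboolP; exact: tc_refl. Qed.

Lemma tcongb_sym : symmetric tcongb.
Proof. by move=> s t; apply/asboolP/asboolP; exact: tc_sym. Qed.

Lemma tcongb_trans : transitive tcongb.
Proof.
by move=> t s u /asboolP st /asboolP tu; apply/asboolP; exact: tc_trans st tu.
Qed.

Canonical tcong_equiv := EquivRel tcongb tcongb_refl tcongb_sym tcongb_trans.

Definition tensor := {eq_quot tcong_equiv}.
HB.instance Definition _ := Choice.on tensor.

Definition tcls (s : seq (A * B)) : tensor := \pi_(tensor) s.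
Definition trep (x : tensor) : seq (A * B) := repr x.

Lemma trepK x : tcls (trep x) = x. Proof. exact: reprK. Qed.

Lemma tclsP s t : tcong s t <-> tcls s = tcls t.
Proof.
split=> [st|/eqmodP/asboolP //].
by apply/eqmodP; apply/asboolP.
Qed.

Lemma trep_cong s : tcong (trep (tcls s)) s.
Proof. by apply/tclsP; rewrite trepK. Qed.

Lemma tcls_ind (P : tensor -> Prop) : (forall s, P (tcls s)) -> forall x, P x.
Proof. by move=> Ps x; rewrite -(trepK x). Qed.

Definition tadd x y := tcls (trep x ++ trep y).
Definition topp x := tcls [seq (- p.1, p.2) | p <- trep x].

Lemma taddE s t : tadd (tcls s) (tcls t) = tcls (s ++ t).
Proof. by apply/tclsP; apply: tc_cat; exact: trep_cong. Qed.

Lemma taddA : associative tadd.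
Proof.
elim/tcls_ind=> s; elim/tcls_ind=> t; elim/tcls_ind=> r.
by rewrite !taddE catA.
Qed.

Lemma taddC : commutative tadd.
Proof.
elim/tcls_ind=> s; elim/tcls_ind=> t.
by rewrite !taddE; apply/tclsP; exact: tc_catC.
Qed.

Lemma tadd0 : left_id (tcls [::]) tadd.
Proof. by elim/tcls_ind=> s; rewrite !taddE. Qed.

Lemma taddN : left_inverse (tcls [::]) topp tadd.
Proof.
move=> x; rewrite -{2}(trepK x) taddE; apply/tclsP.
elim: (trep x) => [|[a b] s IHs] /=; first exact: tc_refl.
set s' := [seq _ | _ <- s] in IHs *.
apply: (@tc_trans _ ([:: (- a, b); (a, b)] ++ (s' ++ s))).
  rewrite -[X in tcong X]/([:: (- a, b)] ++ (s' ++ [:: (a, b)] ++ s)).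
  rewrite -[X in tcong _ X]/([:: (- a, b)] ++ ([:: (a, b)] ++ s' ++ s)).
  apply: tc_cat; first exact: tc_refl.
  by rewrite !catA; apply: tc_cat; [exact: tc_catC | exact: tc_refl].
rewrite -[X in tcong _ X]cat0s; apply: tc_cat => //.
by apply: tc_trans (tc_zero b); rewrite -(addNr a); apply: tc_sym; exact: tc_addl.
Qed.

HB.instance Definition _ := GRing.isZmodule.Build tensor taddA taddC tadd0 taddN.

Definition tens (a : A) (b : B) : tensor := tcls [:: (a, b)].

Lemma tensDl a a' b : tens (a + a') b = tens a b + tens a' b.
Proof. by rewrite [RHS]taddE; apply/tclsP; exact: tc_addl. Qed.

Lemma tensDr a b b' : tens a (b + b') = tens a b + tens a b'.
Proof. by rewrite [RHS]taddE; apply/tclsP; exact: tc_addr. Qed.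

Lemma tensZ c a b : tens (c%:S * a) b = tens a (c%:S * b).
Proof. by apply/tclsP; exact: tc_scale. Qed.

Lemma tens0l b : tens 0 b = 0.
Proof. by apply/tclsP; exact: tc_zero. Qed.

Lemma tens_ind (P : tensor -> Prop) :
  P 0 -> (forall a b x, P x -> P (tens a b + x)) -> forall x, P x.
Proof.
move=> P0 PD; elim/tcls_ind; elim=> [|[a b] s IHs]; first exact: P0.
by have := PD a b _ IHs; rewrite [X in P X]taddE.
Qed.

Section Lift.
Variables (W : zmodType) (f : A -> B -> W).

(* The additive map determined by tens a b |-> f a b; meaningful when f is balanced,
   see [tlift_tens]. *)
Definition tlift (x : tensor) : W := \sum_(p <- trep x) f p.1 p.2.

Definition balanced :=
  [/\ forall a a' b, f (a + a') b = f a b + f a' b,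
      forall a b b', f a (b + b') = f a b + f a b'
    & forall c a b, f (c%:S * a) b = f a (c%:S * b)].

Hypothesis fB : balanced.

Lemma tlift_cong s t : tcong s t ->
  \sum_(p <- s) f p.1 p.2 = \sum_(p <- t) f p.1 p.2.
Proof.
have [fDl fDr fZ] := fB; elim=> {s t} //.
- by move=> s t r _ -> _ ->.
- by move=> s s' t t' _ eqs _ eqt; rewrite !big_cat /= eqs eqt.
- by move=> s t; rewrite !big_cat /= addrC.
- by move=> a a' b; rewrite !big_cons big_nil fDl !addr0.
- by move=> a b b'; rewrite !big_cons big_nil fDr !addr0.
- by move=> c a b; rewrite !big_cons big_nil fZ.
- move=> b; rewrite big_cons !big_nil addr0.
  by apply: (addIr (f 0 b)); rewrite -fDl !add0r.
Qed.

Lemma tlift_cls s : tlift (tcls s) = \sum_(p <- s) f p.1 p.2.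
Proof. by apply: tlift_cong; exact: trep_cong. Qed.

Lemma tlift_tens u v : tlift (tens u v) = f u v.
Proof. by rewrite tlift_cls big_cons big_nil addr0. Qed.

Lemma tliftD x y : tlift (x + y) = tlift x + tlift y.
Proof.
elim/tcls_ind: x => s; elim/tcls_ind: y => t.
by rewrite [X in tlift X]taddE !tlift_cls big_cat.
Qed.

Lemma tlift0 : tlift 0 = 0.
Proof. by apply: (addIr (tlift 0)); rewrite -tliftD !add0r. Qed.

End Lift.

Lemma tensor_ext (W : zmodType) (f g : tensor -> W) :
    {morph f : x y / x + y} -> {morph g : x y / x + y} ->
  (forall a b, f (tens a b) = g (tens a b)) -> f =1 g.
Proof.
move=> fD gD fg x; elim/tens_ind: x => [|a b x IHx].
  have z (h : tensor -> W) : {morph h : x y / x + y} -> h 0 = 0.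
    by move=> hD; apply: (addIr (h 0)); rewrite -hD !add0r.
  by rewrite !z.
by rewrite fD gD fg IHx.
Qed.

(** The algebra structure *)

Definition tmul (x y : tensor) : tensor :=
  tlift (fun a b => tlift (fun a' b' => tens (a * a') (b * b')) y) x.

Lemma tmul_balancedr a b : balanced (fun a' b' => tens (a * a') (b * b')).
Proof.
split=> *; first by rewrite mulrDr tensDl.
- by rewrite mulrDr tensDr.
- by rewrite !scstCA tensZ.
Qed.

Lemma tmul_balancedl y :
  balanced (fun a b => tlift (fun a' b' => tens (a * a') (b * b')) y).
Proof.
split=> [a1 a2 b|a b1 b2|c a b].
- by rewrite -big_split; apply: eq_bigr => p _; rewrite mulrDl tensDl.
- by rewrite -big_split; apply: eq_bigr => p _; rewrite mulrDl tensDr.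
- by apply: eq_bigr => p _; rewrite -!mulrA tensZ.
Qed.

Lemma tmulDl : left_distributive tmul +%R.
Proof. by move=> x y z; rewrite /tmul tliftD //; exact: tmul_balancedl. Qed.

Lemma tmulDr : right_distributive tmul +%R.
Proof.
move=> x y z; rewrite -big_split; apply: eq_bigr => p _ /=.
by rewrite tliftD //; exact: tmul_balancedr.
Qed.

Lemma tmul_tens a b a' b' : tmul (tens a b) (tens a' b') = tens (a * a') (b * b').
Proof.
rewrite /tmul tlift_tens ?tlift_tens //; first exact: tmul_balancedr.
exact: tmul_balancedl.
Qed.

Lemma tmulA : associative tmul.
Proof.
move=> x y z; move: x.
apply: tensor_ext => [x x'|x x'|a b]; rewrite ?tmulDl //; move: y.
apply: tensor_ext => [y y'|y y'|a' b']; rewrite ?(tmulDl, tmulDr) //; move: z.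
apply: tensor_ext => [z z'|z z'|a'' b'']; rewrite ?(tmulDl, tmulDr) //.
by rewrite !tmul_tens !mulrA.
Qed.

Lemma tmul1 : left_id (tens 1 1) tmul.
Proof.
apply: tensor_ext => [x y|x y|a b] //; first by rewrite tmulDr.
by rewrite tmul_tens !mul1r.
Qed.

Lemma tmulr1 : right_id (tens 1 1) tmul.
Proof.
apply: tensor_ext => [x y|x y|a b] //; first by rewrite tmulDl.
by rewrite tmul_tens !mulr1.
Qed.

HB.instance Definition _ :=
  GRing.Zmodule_isPzRing.Build tensor tmulA tmul1 tmulr1 tmulDl tmulDr.

Lemma tensM a a' b b' : tens a b * tens a' b' = tens (a * a') (b * b').
Proof. exact: tmul_tens. Qed.

Definition tcst (c : C) : tensor := tens c%:S 1.

Lemma tcst1 : tcst 1 = 1. Proof. by rewrite /tcst scst1. Qed.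

Lemma tcstD : {morph tcst : c d / c + d}.
Proof. by move=> c d; rewrite /tcst scstD tensDl. Qed.

Lemma tcstM : {morph tcst : c d / c * d}.
Proof. by move=> c d; rewrite /tcst tensM scstM mulr1. Qed.

Lemma tcstC c (x : tensor) : tcst c * x = x * tcst c.
Proof.
move: x; apply: tensor_ext => [x y|x y|a b]; rewrite ?mulrDl ?mulrDr //.
by rewrite !tensM scstC mul1r mulr1.
Qed.

Definition tstar : tensor -> tensor := tlift (fun a b => tens (star a) (star b)).

Lemma tstar_balanced : balanced (fun a b => tens (star a) (star b)).
Proof.
split=> *; first by rewrite starD tensDl.
- by rewrite starD tensDr.
- by rewrite !starM !star_scst -!scstC tensZ.
Qed.

Lemma tstarD : {morph tstar : x y / x + y}.
Proof. exact: (tliftD tstar_balanced). Qed.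

Lemma tstar_tens a b : tstar (tens a b) = tens (star a) (star b).
Proof. exact: (tlift_tens tstar_balanced). Qed.

Lemma tstarK : involutive tstar.
Proof.
apply: tensor_ext => [x y|x y|a b] //; first by rewrite !tstarD.
by rewrite !tstar_tens !starK.
Qed.

Lemma tstarM (x y : tensor) : tstar (x * y) = tstar y * tstar x.
Proof.
move: x; apply: tensor_ext => [x x'|x x'|a b].
- by rewrite mulrDl tstarD.
- by rewrite tstarD mulrDr.
move: y; apply: tensor_ext => [y y'|y y'|a' b'].
- by rewrite mulrDr tstarD.
- by rewrite tstarD mulrDl.
by rewrite tensM !tstar_tens tensM !starM.
Qed.

Lemma star1 (D : starAlgType C) : star (1 : D) = 1.
Proof. by rewrite -[LHS]mul1r -{1}(starK 1) -starM mul1r starK. Qed.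

Lemma tstar_cst c : tstar (tcst c) = tcst c^*.
Proof. by rewrite tstar_tens star_scst star1. Qed.

HB.instance Definition _ := isStarAlgebra.Build C tensor
  tcst1 tcstD tcstM tcstC tstarK tstarD tstarM tstar_cst.

Lemma tens_star a b : star (tens a b) = tens (star a) (star b).
Proof. exact: tstar_tens. Qed.

End Tensor.

Notation "A ⊗ B" := (tensor A%type B%type) (at level 40, left associativity) : type_scope.
Notation "a ⊗ b" := (tens a b) (at level 40, left associativity) : ring_scope.

Section TensorMaps.
Variable C : numClosedFieldType.

Definition star_linear (A B : starAlgType C) (f : A -> B) : Prop :=
  {morph f : x y / x + y} /\ forall (c : C) x, f (c%:S * x) = c%:S * f x.

Lemma star_hom_linear (A B : starAlgType C) (f : A -> B) :
  star_hom f -> star_linear f.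
Proof. by move=> [fD fM fC _]; split=> // c x; rewrite fM fC. Qed.

(* The linear map f (x) g; meaningful for linear f and g, see [tmap_tens]. *)
Definition tmap (A A' B B' : starAlgType C) (f : A -> A') (g : B -> B') :
  A ⊗ B -> A' ⊗ B' := tlift (fun a b => f a ⊗ g b).

Lemma tmap_tens (A A' B B' : starAlgType C) (f : A -> A') (g : B -> B') a b :
  star_linear f -> star_linear g -> tmap f g (a ⊗ b) = f a ⊗ g b.
Proof.
move=> [fD fZ] [gD gZ]; rewrite /tmap tlift_tens //; split=> *.
- by rewrite fD tensDl.
- by rewrite gD tensDr.
- by rewrite fZ gZ tensZ.
Qed.

Definition tassoc (A B D : starAlgType C) : (A ⊗ B) ⊗ D -> A ⊗ (B ⊗ D) :=
  tlift (fun x d => tlift (fun a b => a ⊗ (b ⊗ d)) x).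

Lemma tassoc_tens (A B D : starAlgType C) (a : A) (b : B) (d : D) :
  tassoc ((a ⊗ b) ⊗ d) = a ⊗ (b ⊗ d).
Proof.
have B1 d' : balanced (fun (a : A) (b : B) => a ⊗ (b ⊗ d')).
  split=> *; first exact: tensDl.
  - by rewrite tensDl tensDr.
  - by rewrite tensZ /scst /= tensM mul1r.
rewrite /tassoc tlift_tens ?tlift_tens //; split=> [x x' d'|x d1 d2|c x d'].
- exact: tliftD.
- by rewrite -big_split /=; apply: eq_bigr => p _; rewrite !tensDr.
- move: x; apply: tensor_ext => [x y|x y|a' b'].
  + by rewrite mulrDr tliftD.
  + by rewrite tliftD.
  by rewrite {1}/scst /= tensM mul1r !tlift_tens // tensZ /scst /= tensM mul1r -tensZ.
Qed.

End TensorMaps.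

(** * Hopf *-algebras and quantum spheres *)

Section QuantumSpheres.
Variable C : numClosedFieldType.

Inductive Z2_rel : sterm C unit -> sterm C unit -> Prop :=
  | Z2_self_adjoint : Z2_rel ((Gen tt)^*)%ST (Gen tt)
  | Z2_square : Z2_rel (Gen tt * Gen tt)%ST (Cst 1).

Definition OZ2 : starAlgType C := presented Z2_rel.
Definition Z2u : OZ2 := pgen Z2_rel tt.

(* The Laurent polynomial algebra C[v, v^-1] with v^* = v^-1, as the universal
   *-algebra on a unitary v. *)
Inductive U1_rel : sterm C unit -> sterm C unit -> Prop :=
  | U1_unitaryr : U1_rel (Gen tt * (Gen tt)^*)%ST (Cst 1)
  | U1_unitaryl : U1_rel ((Gen tt)^* * Gen tt)%ST (Cst 1).

Definition OU1 : starAlgType C := presented U1_rel.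
Definition U1v : OU1 := pgen U1_rel tt.

Definition U1comul : OU1 -> OU1 ⊗ OU1 := plift (fun=> U1v ⊗ U1v).
Definition pi2 : OU1 -> OZ2 := plift (fun=> Z2u).

Variable q : C.

(* The relations common to the two families of spheres and to A^{2n}, imposed
   on terms z_0, ..., z_n. *)
Inductive sphere_rel (X : Type) (n : nat) (z : 'I_n.+1 -> sterm C X) :
    sterm C X -> sterm C X -> Prop :=
  | sphere_zz (i j : 'I_n.+1) : (i < j)%N ->
      sphere_rel z (z i * z j)%ST (Cst q * (z j * z i))%ST
  | sphere_zz_star i j : i != j ->
      sphere_rel z (z i * (z j)^*)%ST (Cst q * ((z j)^* * z i))%ST
  | sphere_normal i :
      sphere_rel z (z i * (z i)^*)%ST
        ((z i)^* * z i + Cst (q ^- 2 - 1) *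
           \big[Add/Cst 0]_(m < n.+1 | (i < m)%N) (z m * (z m)^*))%ST
  | sphere_sum :
      sphere_rel z (\big[Add/Cst 0]_(m < n.+1) (z m * (z m)^*))%ST (Cst 1).

(* [even] selects S^{2n} (where z_n is self-adjoint) rather than S^{2n+1}. *)
Inductive qsphere_rel (even : bool) (n : nat) :
    sterm C 'I_n.+1 -> sterm C 'I_n.+1 -> Prop :=
  | qsphere_common s t : sphere_rel Gen s t -> qsphere_rel even s t
  | qsphere_self_adjoint : even ->
      qsphere_rel even ((Gen ord_max)^*)%ST (Gen ord_max).

Definition OS (even : bool) (n : nat) : starAlgType C :=
  presented (@qsphere_rel even n).
Definition Sz even n (i : 'I_n.+1) : OS even n := pgen (@qsphere_rel even n) i.

Definition coact even n : OS even n -> OS even n ⊗ OZ2 :=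
  plift (fun i => Sz even i ⊗ Z2u).

Definition OSodd (n : nat) : starAlgType C := OS false n.
Definition OSeven (n : nat) : starAlgType C := OS true n.
Definition coact_odd n : OSodd n -> OSodd n ⊗ OZ2 := @coact false n.
Definition coact_even n : OSeven n -> OSeven n ⊗ OZ2 := @coact true n.

(* Generators: Some i is zeta_i and None is xi. *)
Inductive A2n_rel (n : nat) :
    sterm C (option 'I_n.+1) -> sterm C (option 'I_n.+1) -> Prop :=
  | A2n_common s t : sphere_rel (fun i => Gen (Some i)) s t -> A2n_rel s t
  | A2n_unitaryr : A2n_rel (Gen None * (Gen None)^*)%ST (Cst 1)
  | A2n_unitaryl : A2n_rel ((Gen None)^* * Gen None)%ST (Cst 1)
  | A2n_central t : A2n_rel (Gen None * t)%ST (t * Gen None)%ST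
  | A2n_star : A2n_rel ((Gen (Some ord_max))^*)%ST
                       (Gen (Some ord_max) * Gen None)%ST.

Definition A2n (n : nat) : starAlgType C := presented (@A2n_rel n).

(* rho is a right coaction on A, lam a left coaction on P. *)
Definition cotensor (A H P : starAlgType C) (rho : A -> A ⊗ H) (lam : P -> H ⊗ P) :
  set (A ⊗ P) := [set x | tassoc (tmap rho idfun x) = tmap idfun lam x].

Definition prolongation (A : starAlgType C) (rho : A -> A ⊗ OZ2) :
    set (A ⊗ OU1) :=
  cotensor rho (fun h => tmap pi2 idfun (U1comul h)).

Lemma Z2u_star : star Z2u = Z2u.
Proof.
by rewrite /star /= pstarE; apply/pclsP; apply: sc_rel; exact: Z2_self_adjoint.
Qed.

Lemma Z2u_sqr : Z2u * Z2u = 1.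
Proof.
by rewrite /GRing.mul /= pmulE; apply/pclsP; apply: sc_rel; exact: Z2_square.
Qed.

Lemma U1v_unitaryr : U1v * star U1v = 1.
Proof.
rewrite /star /= pstarE /GRing.mul /= pmulE.
by apply/pclsP; apply: sc_rel; exact: U1_unitaryr.
Qed.

Lemma U1v_unitaryl : star U1v * U1v = 1.
Proof.
rewrite /star /= pstarE /GRing.mul /= pmulE.
by apply/pclsP; apply: sc_rel; exact: U1_unitaryl.
Qed.

Lemma pi2P s t : U1_rel s t -> seval (fun=> Z2u) s = seval (fun=> Z2u) t.
Proof. by case=> /=; rewrite Z2u_star Z2u_sqr scst1. Qed.

Lemma pi2_hom : star_hom pi2.
Proof. exact: plift_hom pi2P. Qed.

Lemma pi2_v : pi2 U1v = Z2u.
Proof. exact: plift_gen pi2P _. Qed.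

Lemma U1comulP s t : U1_rel s t ->
  seval (fun=> U1v ⊗ U1v) s = seval (fun=> U1v ⊗ U1v) t.
Proof.
by case=> /=; rewrite tens_star tensM ?U1v_unitaryr ?U1v_unitaryl scst1.
Qed.

Lemma U1comul_hom : star_hom U1comul.
Proof. exact: plift_hom U1comulP. Qed.

Lemma U1comul_v : U1comul U1v = U1v ⊗ U1v.
Proof. exact: plift_gen U1comulP _. Qed.

Lemma seval_sum (X : Type) (A : starAlgType C) (f : X -> A)
    (I : Type) (r : seq I) (P : pred I) (F : I -> sterm C X) :
  seval f (\big[Add/Cst 0]_(i <- r | P i) F i) = \sum_(i <- r | P i) seval f (F i).
Proof. by apply: big_morph => //=; exact: scst0. Qed.

Lemma seval_pgen (X : Type) (R : sterm C X -> sterm C X -> Prop) t :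
  seval (pgen R) t = pcls R t.
Proof.
elim: t => //= [s -> t ->|s -> t ->|t ->].
- exact: paddE.
- exact: pmulE.
- exact: pstarE.
Qed.

Lemma coactP even n s t : @qsphere_rel even n s t ->
  seval (fun i => Sz even i ⊗ Z2u) s = seval (fun i => Sz even i ⊗ Z2u) t.
Proof.
move=> Rst; have : seval (@Sz even n) s = seval (@Sz even n) t.
  by rewrite !seval_pgen; apply/pclsP; apply: sc_rel.
have zzE (i j : 'I_n.+1) : (Sz even i ⊗ Z2u) * star (Sz even j ⊗ Z2u) =
    (Sz even i * star (Sz even j)) ⊗ (1 : OZ2).
  by rewrite tens_star Z2u_star tensM Z2u_sqr.
have sumE (P : pred 'I_n.+1) :
    \sum_(i | P i) (Sz even i ⊗ Z2u) * star (Sz even i ⊗ Z2u) =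
    (\sum_(i | P i) Sz even i * star (Sz even i)) ⊗ (1 : OZ2).
  rewrite (eq_bigr _ (fun i _ => zzE i i)).
  rewrite (big_morph (fun x => x ⊗ (1 : OZ2)) (id1 := 0) (op1 := +%R)) //.
    by move=> x y; exact: tensDl.
  exact: tens0l.
have scalE a (x : OS even n) (h : OZ2) : a%:S * (x ⊗ h) = (a%:S * x) ⊗ h.
  by rewrite {1}/scst /= tensM mul1r.
case: Rst => [{}s {}t [i j _|i j _|i|]|_] /=.
- by rewrite !(tensM (Sz even _)) scalE => ->.
- by rewrite zzE tens_star Z2u_star tensM Z2u_sqr scalE => ->.
- rewrite !seval_sum zzE sumE tens_star Z2u_star tensM Z2u_sqr scalE.
  by rewrite -tensDl => ->.
- by rewrite !seval_sum sumE => ->.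
- by rewrite tens_star Z2u_star => ->.
Qed.

Lemma coact_hom even n : star_hom (@coact even n).
Proof. exact: plift_hom (@coactP even n). Qed.

Lemma coact_z even n i : coact (Sz even i) = Sz even i ⊗ Z2u :> OS even n ⊗ OZ2.
Proof. exact: plift_gen (@coactP even n) _. Qed.

End QuantumSpheres.

(* Main.v *)
Require Import Defs.
From HB Require Import structures.
From mathcomp Require Import all_boot all_order all_algebra.
From mathcomp Require Import boolp classical_sets reals.
From mathcomp Require Import complex.
Import Order.TTheory GRing.Theory Num.Theory.
Local Open Scope ring_scope.
Local Open Scope complex_scope.

(** Let A be the coordinate algebra of the sphere, P its prolongation, and v the
    generator of O(U(1)), viewed in A ⊗ O(U(1)).

    A is graded by Z/2 with every z_i and z_i^* odd, and P consists of the
    elements whose A-degree has the parity of their degree in v. Hence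
    A ⊗ O(U(1)) = P ⊕ P v, where v is a central unitary whose square lies in P:
    the tensor product arises from P by adjoining a square root of a central
    unitary. This suggests how to recognize P. For a *-algebra D with a central
    unitary u, let D[w] be D with a central unitary w adjoined such that w^2 = u
    ([sqrt_ext]). If D[w] is isomorphic to A ⊗ O(U(1)) by a map that sends w to v
    and D into P, then it sends D onto P ([prolongation_isomorphic]).

    In both cases D is generated by u and by elements d_i that are to be sent to
    z_i v, with u sent to v^2. For the odd spheres all relations are homogeneous
    for deg z_i = 1, deg z_i^* = -1, so D = A ⊗ O(U(1)) with d_i = z_i and u = v
    will do. For the even spheres the relation z_n^* = z_n is not homogeneous: it
    gives (z_n v)^* = (z_n v) v^-2, which is the last relation of A^{2n} for
    d_i = zeta_i and u = xi^*. The inverse sends z_i to d_i w^* and v to w. It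
    exists because the sphere relations survive multiplication of all generators
    by one central unitary ([sphere_family_twist]) and, in the even case, because
    xi = w^-2 makes zeta_n w^* self-adjoint. That the two maps are inverse to each
    other is checked on generators, so no linear basis of these algebras enters.

    What remains is P ∩ P v = 0. The two sides of the cotensor condition, composed
    with the character of O(Z_2) that sends the generator to -1, become two
    automorphisms of A ⊗ O(U(1)): one negates the z_i and fixes v, the other fixes
    the z_i and negates v ([prolongation_sign]). They agree on P, but on P v they
    agree only at 0. *)

Set Implicit Arguments.
Unset Strict Implicit.
Unset Printing Implicit Defensive.

(** * Homomorphisms, *-subalgebras and central elements *)

Lemma star0 (C : numClosedFieldType) (A : starAlgType C) : star (0 : A) = 0.
Proof. by rewrite -(scst0 A) star_scst conjC0. Qed.

Section StarHom.
Variables (C : numClosedFieldType) (A B D : starAlgType C).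

Lemma star_hom1 (f : A -> B) : star_hom f -> f 1 = 1.
Proof. by case=> _ _ fC _; rewrite -(scst1 (s := A)) fC scst1. Qed.

Lemma star_hom0 (f : A -> B) : star_hom f -> f 0 = 0.
Proof. by case=> _ _ fC _; rewrite -(scst0 A) fC scst0. Qed.

Lemma star_homB (f : A -> B) x y : star_hom f -> f (x - y) = f x - f y.
Proof.
by case=> fD _ _ _; apply: (addIr (f y)); rewrite -fD !subrK.
Qed.

Lemma star_hom_sum (f : A -> B) (I : finType) (P : pred I) (F : I -> A) :
  star_hom f -> f (\sum_(i | P i) F i) = \sum_(i | P i) f (F i).
Proof.
by move=> fH; apply: big_morph; [case: fH | exact: star_hom0].
Qed.

Lemma star_hom_comp (g : B -> D) (f : A -> B) :
  star_hom g -> star_hom f -> star_hom (g \o f).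
Proof.
move=> [gD gM gC gS] [fD fM fC fS].
by split=> [x y|x y|c|x] /=; rewrite ?fD ?fM ?fC ?fS.
Qed.

Lemma star_hom_id : star_hom (@idfun A).
Proof. by []. Qed.

Lemma star_subalgebra_equalizer (f g : A -> B) :
  star_hom f -> star_hom g -> star_subalgebra [set x | f x = g x].
Proof.
move=> [fD fM fC fS] [gD gM gC gS].
split=> [c|x y|x y|x] /=; first by rewrite fC gC.
- by rewrite fD gD => -> ->.
- by rewrite fM gM => -> ->.
- by rewrite fS gS => ->.
Qed.

Lemma star_subalgebra_preim (f : A -> B) (S : set B) :
  star_hom f -> star_subalgebra S -> star_subalgebra (f @^-1` S)%classic.
Proof.
move=> [fD fM fC fS] [SC SD SM SS].
split=> [c|x y|x y|x] /=; first by rewrite fC.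
- by rewrite fD; exact: SD.
- by rewrite fM; exact: SM.
- by rewrite fS; exact: SS.
Qed.

Definition central (x : A) := forall y, x * y = y * x.

Lemma central_star_subalgebra : star_subalgebra central.
Proof.
split=> [c y|x y xC yC z|x y xC yC z|x xC y]; first exact: scstC.
- by rewrite mulrDl mulrDr xC yC.
- by rewrite -mulrA yC mulrA xC mulrA.
- by rewrite -[y]starK -!starM xC.
Qed.

Lemma central_star x : central x -> central (star x).
Proof. by case: central_star_subalgebra => _ _ _; apply. Qed.

Lemma centralM x y : central x -> central y -> central (x * y).
Proof. by case: central_star_subalgebra => _ _ + _; apply. Qed.

End StarHom.

Record central_unitary (C : numClosedFieldType) (A : starAlgType C) := CentralUnitary {
  cu_val :> A;
  cu_central : central cu_val;
  cu_unitary : cu_val * star cu_val = 1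
}.

Section CentralUnitary.
Variables (C : numClosedFieldType) (A : starAlgType C).

Lemma cu_unitaryl (c : central_unitary A) : star c * (c : A) = 1.
Proof. by rewrite -cu_central cu_unitary. Qed.

Lemma cu_star_unitary (c : central_unitary A) : star c * star (star c) = 1.
Proof. by rewrite starK cu_unitaryl. Qed.

Definition cu_star (c : central_unitary A) :=
  CentralUnitary (central_star (cu_central c)) (cu_star_unitary c).

Lemma cu_mul_unitary (c d : central_unitary A) :
  (c : A) * (d : A) * star ((c : A) * (d : A)) = 1.
Proof. by rewrite starM -mulrA (mulrA (d : A)) cu_unitary mul1r cu_unitary. Qed.

Definition cu_mul (c d : central_unitary A) :=
  CentralUnitary (centralM (cu_central c) (cu_central d)) (cu_mul_unitary c d).

End CentralUnitary.

Definition generates (C : numClosedFieldType) (A : starAlgType C) (G : set A) :=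
  forall S : set A, star_subalgebra S -> (forall x, G x -> S x) -> forall x, S x.

Section Generates.
Variables (C : numClosedFieldType) (A B : starAlgType C).

(** The equalizer of two homomorphisms is a *-subalgebra; this is how all
    identities between homomorphisms are reduced to generators. *)
Lemma star_hom_ext (G : set A) (f g : A -> B) : generates G ->
  star_hom f -> star_hom g -> (forall x, G x -> f x = g x) -> f =1 g.
Proof. by move=> GA fH gH; apply: GA; exact: star_subalgebra_equalizer. Qed.

Lemma generates_pgen (X : Type) (R : sterm C X -> sterm C X -> Prop) :
  generates (range (pgen R)).
Proof.
move=> S [SC SD SM SS] GS; apply: pcls_ind; elim=> [x|c|s Hs t Ht|s Hs t Ht|t Ht].
- by apply: GS; exists x.
- exact: SC.
- by have := SD _ _ Hs Ht; rewrite [X in S X]paddE.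
- by have := SM _ _ Hs Ht; rewrite [X in S X]pmulE.
- by have := SS _ Ht; rewrite [X in S X]pstarE.
Qed.

End Generates.

(** * Homomorphisms out of a tensor product *)

Section TensorHom.
Variables (C : numClosedFieldType) (A B E : starAlgType C).

Definition tinl (a : A) : A ⊗ B := a ⊗ 1.
Definition tinr (b : B) : A ⊗ B := 1 ⊗ b.

Lemma tens_inlr a b : a ⊗ b = tinl a * tinr b.
Proof. by rewrite tensM mulr1 mul1r. Qed.

Lemma tens_inrl a b : a ⊗ b = tinr b * tinl a.
Proof. by rewrite tensM mulr1 mul1r. Qed.

Lemma tinl_hom : star_hom tinl.
Proof.
split=> [x y|x y|c|x]; rewrite /tinl.
- exact: tensDl.
- by rewrite tensM mulr1.
- by [].
- by rewrite tens_star star1.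
Qed.

Lemma tinr_hom : star_hom tinr.
Proof.
split=> [x y|x y|c|x]; rewrite /tinr.
- exact: tensDr.
- by rewrite tensM mulr1.
- by rewrite -[c%:S]mulr1 -tensZ mulr1.
- by rewrite tens_star star1.
Qed.

Lemma generates_tens (GA : set A) (GB : set B) : generates GA -> generates GB ->
  generates (tinl @` GA `|` tinr @` GB)%classic.
Proof.
move=> GAg GBg S Salg GS; have [SC SD SM SS] := Salg.
have Sl : forall a, S (tinl a).
  apply: GAg => [|a Ga]; first exact: star_subalgebra_preim tinl_hom Salg.
  by apply: GS; left; exists a.
have Sr : forall b, S (tinr b).
  apply: GBg => [|b Gb]; first exact: star_subalgebra_preim tinr_hom Salg.
  by apply: GS; right; exists b.
apply: tens_ind => [|a b x Sx]; first by rewrite -(scst0 (A ⊗ B)%type).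
by apply: SD => //; rewrite tens_inlr; exact: SM.
Qed.

Lemma central_tinr b : central b -> central (tinr b).
Proof.
move=> bC; apply: tensor_ext => [x y|x y|a b'].
- exact: mulrDr.
- exact: mulrDl.
- by rewrite !tensM mul1r mulr1 bC.
Qed.

(** The universal map out of A ⊗ B; it is a homomorphism when the images of f
    and g commute, see [tpair_hom]. *)
Definition tpair (f : A -> E) (g : B -> E) : A ⊗ B -> E :=
  tlift (fun a b => f a * g b).

Variables (f : A -> E) (g : B -> E).
Hypotheses (fH : star_hom f) (gH : star_hom g).
Hypothesis fgC : forall a b, f a * g b = g b * f a.

Lemma tpair_balanced : balanced (fun a b => f a * g b).
Proof.
case: fH gH => fD fM fC _ [gD gM gC _]; split=> *.
- by rewrite fD mulrDl.
- by rewrite gD mulrDr.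
- by rewrite fM gM fC gC scstCA mulrA.
Qed.

Lemma tpair_tens a b : tpair f g (a ⊗ b) = f a * g b.
Proof. by rewrite /tpair (tlift_tens tpair_balanced). Qed.

Lemma tpair_inl a : tpair f g (tinl a) = f a.
Proof. by rewrite tpair_tens (star_hom1 gH) mulr1. Qed.

Lemma tpair_inr b : tpair f g (tinr b) = g b.
Proof. by rewrite tpair_tens (star_hom1 fH) mul1r. Qed.

Lemma tpair_hom : star_hom (tpair f g).
Proof.
have tD : {morph tpair f g : x y / x + y} := tliftD tpair_balanced.
have [_ fM fC fS] := fH; have [_ gM _ gS] := gH.
split=> // [x y|c|].
- move: x; apply: tensor_ext => [x x'|x x'|a b]; rewrite ?mulrDl ?tD ?mulrDl //.
  move: y; apply: tensor_ext => [y y'|y y'|a' b']; rewrite ?mulrDr ?tD ?mulrDr //.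
  rewrite tensM !tpair_tens fM gM -!mulrA; congr (_ * _).
  by rewrite !mulrA fgC.
- by rewrite [LHS]tpair_inl.
- apply: tensor_ext => [x y|x y|a b].
  + by rewrite starD tD.
  + by rewrite tD starD.
  by rewrite tens_star !tpair_tens fgC fS gS starM.
Qed.

End TensorHom.

Arguments tinl {C} A B a.
Arguments tinr {C} A B b.

Section TensorMapHom.
Variable C : numClosedFieldType.

(** Both f ⊗ g and the associativity map are pairings of homomorphisms with
    commuting images, which makes them homomorphisms without computation on
    sums of pure tensors. *)
Lemma tmap_hom (A A' B B' : starAlgType C) (f : A -> A') (g : B -> B') :
  star_hom f -> star_hom g -> star_hom (tmap f g).
Proof.
move=> fH gH.
have -> : tmap f g = tpair (tinl A' B' \o f) (tinr A' B' \o g).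
  by congr tlift; apply/funext => a; apply/funext => b; rewrite tens_inlr.
apply: tpair_hom.
- exact: star_hom_comp (tinl_hom _ _) fH.
- exact: star_hom_comp (tinr_hom _ _) gH.
- by move=> a b /=; rewrite -tens_inlr -tens_inrl.
Qed.

Lemma tassoc_hom (A B D : starAlgType C) : star_hom (@tassoc C A B D).
Proof.
pose il := tinl A (B ⊗ D)%type.
pose im := tinr A (B ⊗ D)%type \o tinl B D.
pose ir := tinr A (B ⊗ D)%type \o tinr B D.
have ilH : star_hom il by exact: tinl_hom.
have imH : star_hom im by exact: star_hom_comp (tinr_hom _ _) (tinl_hom _ _).
have irH : star_hom ir by exact: star_hom_comp (tinr_hom _ _) (tinr_hom _ _).
have ilmC a b : il a * im b = im b * il a.
  by rewrite /il /im /= -tens_inlr -tens_inrl.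
have ilmH := tpair_hom ilH imH ilmC.
have lmrE x d : tlift (fun a b => a ⊗ (b ⊗ d)) x = tpair il im x * ir d.
  rewrite mulr_suml; apply: eq_bigr => -[a b] _ /=.
  by rewrite /il /im /ir /= -mulrA !tensM !mulr1 !mul1r.
have -> : @tassoc C A B D = tpair (tpair il im) ir.
  by congr tlift; apply/funext => x; apply/funext => d; exact: lmrE.
apply: tpair_hom => // x d; move: x; have [mD _ _ _] := ilmH.
apply: tensor_ext => [x y|x y|a b].
- by rewrite mD mulrDl.
- by rewrite mD mulrDr.
- rewrite tpair_tens // /il /im /ir /= /tinl /tinr.
  by rewrite !(tensM, mulr1, mul1r).
Qed.

End TensorMapHom.

(** * Adjoining a square root of a central unitary *)

(** The pair (a, b) stands for a + b w, where w is a central unitary adjoined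
    subject to w^2 = u; then w^* = w^-1 = u^* w. *)
Definition sqrt_ext (C : numClosedFieldType) (A : starAlgType C)
  (u : central_unitary A) : Type := (A * A)%type.

Section SqrtExt.
Variables (C : numClosedFieldType) (A : starAlgType C) (u : central_unitary A).
Local Notation x := (cu_val u).

HB.instance Definition _ := GRing.Zmodule.on (sqrt_ext u).
Local Notation sqrt_ext := (sqrt_ext u).

Definition sqmul (y z : sqrt_ext) : sqrt_ext :=
  (y.1 * z.1 + y.2 * z.2 * x, y.1 * z.2 + y.2 * z.1).
Definition sqone : sqrt_ext := (1, 0).
Definition sqcst (c : C) : sqrt_ext := (c%:S, 0).
Definition sqstar (y : sqrt_ext) : sqrt_ext := (star y.1, star y.2 * star x).

Let xC := cu_central u.
Let xU : x * star x = 1 := cu_unitary u.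

Let mulxA y z : y * x * z = y * z * x.
Proof. by rewrite -mulrA xC mulrA. Qed.

Lemma sqmulA : associative sqmul.
Proof.
move=> [a a'] [b b'] [c c']; rewrite /sqmul /=.
rewrite !(mulrDl, mulrDr, mulrA, mulxA).
by congr (_, _); rewrite [RHS]addrACA; congr (_ + _); exact: addrC.
Qed.

Lemma sqmul1 : left_id sqone sqmul.
Proof. by case=> a b; rewrite /sqmul /= !mul1r !mul0r !addr0. Qed.

Lemma sqmulr1 : right_id sqone sqmul.
Proof. by case=> a b; rewrite /sqmul /= !mulr1 !mulr0 !mul0r addr0 add0r. Qed.

Lemma sqmulDl : left_distributive sqmul +%R.
Proof.
move=> [a a'] [b b'] [c c']; rewrite /sqmul /= !mulrDl.
by congr (_, _); rewrite addrACA.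
Qed.

Lemma sqmulDr : right_distributive sqmul +%R.
Proof.
move=> [a a'] [b b'] [c c']; rewrite /sqmul /= !mulrDr ?mulrDl.
by congr (_, _); rewrite addrACA.
Qed.

HB.instance Definition _ :=
  GRing.Zmodule_isPzRing.Build sqrt_ext sqmulA sqmul1 sqmulr1 sqmulDl sqmulDr.

Lemma sqcst1 : sqcst 1 = 1.
Proof. by rewrite /sqcst scst1. Qed.

Lemma sqcstD : {morph sqcst : c d / c + d}.
Proof. by move=> c d; congr (_, _); [exact: scstD | rewrite /= addr0]. Qed.

Lemma sqcstM : {morph sqcst : c d / c * d}.
Proof.
by move=> c d; rewrite /sqcst scstM; congr (_, _); rewrite /= !(mulr0, mul0r) addr0.
Qed.

Lemma sqcstC c (y : sqrt_ext) : sqcst c * y = y * sqcst c.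
Proof.
case: y => a b; congr (_, _); rewrite /= !(mulr0, mul0r, addr0, add0r);
exact: scstC.
Qed.

Lemma sqstarK : involutive sqstar.
Proof.
case=> a b; rewrite /sqstar /= starM !starK; congr (_, _).
by rewrite xC -mulrA xU mulr1.
Qed.

Lemma sqstarD : {morph sqstar : y z / y + z}.
Proof. by move=> [a a'] [b b']; rewrite /sqstar /= !starD mulrDl. Qed.

Lemma sqstarM (y z : sqrt_ext) : sqstar (y * z) = sqstar z * sqstar y.
Proof.
have xsC := central_star xC.
have mulxsA a b : a * star x * b = a * b * star x by rewrite -mulrA xsC mulrA.
case: y z => [a a'] [b b']; congr (_, _); rewrite /= !(starD, starM).
  congr (_ + _).
  by rewrite xsC !mulrA !mulxsA -(mulrA _ x) xU mulr1.
by rewrite mulrDl !mulrA mulxsA addrC.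
Qed.

Lemma sqstar_cst c : sqstar (sqcst c) = sqcst c^*.
Proof.
rewrite /sqstar /= star_scst; congr (_, _).
by rewrite star0 mul0r.
Qed.

HB.instance Definition _ := isStarAlgebra.Build C sqrt_ext
  sqcst1 sqcstD sqcstM sqcstC sqstarK sqstarD sqstarM sqstar_cst.

Definition sqinc (a : A) : sqrt_ext := (a, 0).
Definition sqgen : sqrt_ext := (0, 1).

Lemma sqinc_hom : star_hom sqinc.
Proof.
split=> [a b|a b|c|a]; congr (_, _); rewrite /= ?addr0 ?mulr0 ?mul0r ?addr0 //.
by rewrite star0 mul0r.
Qed.

Lemma sqgen_central : central sqgen.
Proof. by case=> a b; congr (_, _); rewrite /= !(mul0r, mulr0, mul1r, mulr1, add0r, addr0). Qed.

Lemma sqgen_sqr : sqgen * sqgen = sqinc x.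
Proof. by congr (_, _); rewrite /= !(mul0r, mulr0, mul1r, add0r, addr0). Qed.

Lemma sqgen_unitary : sqgen * star sqgen = 1.
Proof.
congr (_, _); rewrite /= star1 !mul1r mul0r add0r; first by rewrite -xC xU.
exact: star0.
Qed.

End SqrtExt.

Arguments sqinc {C A} u a.
Arguments sqgen {C A} u.

Definition sqroot (C : numClosedFieldType) (A : starAlgType C)
    (u : central_unitary A) : central_unitary (sqrt_ext u) :=
  CentralUnitary (@sqgen_central _ _ u) (sqgen_unitary u).

Section SqrtLift.
Variables (C : numClosedFieldType) (A E : starAlgType C) (u : central_unitary A).
Variables (f : A -> E) (w : central_unitary E).
Hypotheses (fH : star_hom f) (wS : cu_mul w w = f u :> E).

(** The universal property of A[w]: f extends to it once a central unitary square
    root of f u is chosen. *)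
Definition sqlift (y : sqrt_ext u) : E := f y.1 + f y.2 * (w : E).

Lemma sqlift_inc a : sqlift (sqinc u a) = f a.
Proof. by rewrite /sqlift /= (star_hom0 fH) mul0r addr0. Qed.

Lemma sqlift_gen : sqlift (cu_val (sqroot u)) = w.
Proof. by rewrite /sqlift /= (star_hom0 fH) (star_hom1 fH) mul1r add0r. Qed.

Lemma sqlift_hom : star_hom sqlift.
Proof.
have [fD fM fC fS] := fH; rewrite /sqlift.
split=> [[a b] [a' b']|[a b] [a' b']|c|[a b]] /=.
- by rewrite !fD mulrDl addrACA.
- rewrite !(fD, fM) -wS /= !(mulrDl, mulrDr) !mulrA.
  have wA y z : y * (w : E) * z = y * z * (w : E).
    by rewrite -mulrA cu_central mulrA.
  by rewrite !wA [LHS]addrACA; congr (_ + _); exact: addrC.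
- by rewrite (star_hom0 fH) mul0r addr0 fC.
- rewrite fM !fS -wS starD !starM -!mulrA cu_unitaryl mulr1; congr (_ + _).
  by rewrite (cu_central (cu_star w)).
Qed.

End SqrtLift.

(** * Families satisfying the relations of the quantum spheres *)

Section SphereFamily.
Variables (C : numClosedFieldType) (q : C) (n : nat).

(** The relations stated in an algebra rather than on terms, so that they can be
    transported along homomorphisms. *)
Definition sphere_family (E : starAlgType C) (y : 'I_n.+1 -> E) : Prop :=
  [/\ forall i j : 'I_n.+1, (i < j)%N -> y i * y j = q%:S * (y j * y i),
      forall i j, i != j -> y i * star (y j) = q%:S * (star (y j) * y i),
      forall i, y i * star (y i) = star (y i) * y i
        + (q ^- 2 - 1)%:S * \sum_(m < n.+1 | (i < m)%N) y m * star (y m)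
    & \sum_(m < n.+1) y m * star (y m) = 1].

Lemma sphere_familyP (X : Type) (E : starAlgType C) (z : 'I_n.+1 -> sterm C X)
    (g : X -> E) :
  sphere_family (fun i => seval g (z i)) <->
  (forall s t, sphere_rel q z s t -> seval g s = seval g t).
Proof.
split=> [[zz zzs zn zsum] s t []|gR].
- by move=> i j /zz.
- by move=> i j /zzs.
- by move=> i; rewrite /= seval_sum zn.
- by rewrite seval_sum zsum /= scst1.
split=> [i j ij|i j ij|i|].
- exact: gR _ _ (sphere_zz q z ij).
- exact: gR _ _ (sphere_zz_star q z ij).
- by have := gR _ _ (sphere_normal q z i); rewrite /= seval_sum.
- by have := gR _ _ (sphere_sum q z); rewrite /= seval_sum scst1.
Qed.

Lemma sphere_family_hom (E F : starAlgType C) (f : E -> F) (y : 'I_n.+1 -> E) :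
  star_hom f -> sphere_family y -> sphere_family (f \o y).
Proof.
move=> fH; have [fD fM fC fS] := fH.
have fyE i : f (y i) * star (f (y i)) = f (y i * star (y i)) by rewrite fM fS.
case=> zz zzs zn zsum; split=> /= [i j ij|i j ij|i|].
- by rewrite -!fM -fC -fM zz.
- by rewrite -!(fS, fM) -fC -fM zzs.
- rewrite (eq_bigr _ (fun m _ => fyE m)) -star_hom_sum // -fC -!(fS, fM) -fD.
  by rewrite zn.
- by rewrite (eq_bigr _ (fun m _ => fyE m)) -star_hom_sum // zsum star_hom1.
Qed.

(** The relations between y_i y_j and y_j y_i are homogeneous of degree 2, hence
    both sides acquire c^2; in all others each y_i is paired with some y_j^*, and
    c c^* = 1. *)
Lemma sphere_family_twist (E : starAlgType C) (c : central_unitary E)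
    (y : 'I_n.+1 -> E) :
  sphere_family y -> sphere_family (fun i => y i * (c : E)).
Proof.
case: c => c cC cU [zz zzs zn zsum] /=.
have ycE i j : y i * c * star (y j * c) = y i * star (y j).
  by rewrite starM mulrA -(mulrA (y i)) cU mulr1.
have cyE i j : star (y j * c) * (y i * c) = star (y j) * y i.
  rewrite starM (central_star cC) -mulrA (mulrA (star c)) (central_star cC).
  by rewrite -(mulrA (y i)) -cC cU mulr1.
split=> [i j ij|i j ij|i|].
- have ccE a b : a * c * (b * c) = a * b * (c * c).
    by rewrite -mulrA (mulrA c) (cC b) -!mulrA.
  by rewrite !ccE zz // !mulrA.
- by rewrite ycE cyE zzs.
- by under eq_bigr do rewrite ycE; rewrite ycE cyE zn.
- by under eq_bigr do rewrite ycE.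
Qed.

Section Spheres.
Variable even : bool.

Lemma OS_sphere_family : sphere_family (@Sz C q even n).
Proof.
apply/(sphere_familyP Gen (@Sz C q even n)) => s t st.
by rewrite !seval_pgen; apply/pclsP; apply: sc_rel; exact: qsphere_common.
Qed.

Lemma OS_self_adjoint : even -> star (Sz q even ord_max) = Sz q even (@ord_max n).
Proof.
by move=> ev; rewrite [LHS]pstarE; apply/pclsP; apply: sc_rel; exact: qsphere_self_adjoint.
Qed.

Lemma OS_lift (E : starAlgType C) (y : 'I_n.+1 -> E) :
    sphere_family y -> (even -> star (y ord_max) = y ord_max) ->
  exists2 h : OS q even n -> E, star_hom h & forall i, h (Sz q even i) = y i.
Proof.
move=> yF ysa.
have yR s t : qsphere_rel q even s t -> seval y s = seval y t.
  by case=> [{}s {}t|/ysa //]; exact: (sphere_familyP Gen y).1.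
exists (plift y); first exact: plift_hom yR.
by move=> i; exact: plift_gen yR _.
Qed.

End Spheres.

Definition A2n_zeta i : A2n q n := pgen (@A2n_rel C q n) (Some i).
Local Notation zeta := A2n_zeta.
Local Notation xi := (pgen (@A2n_rel C q n) None : A2n q n).

Lemma A2n_sphere_family : sphere_family zeta.
Proof.
apply/(sphere_familyP (fun i => Gen (Some i)) (pgen (@A2n_rel C q n))) => s t st.
by rewrite !seval_pgen; apply/pclsP; apply: sc_rel; exact: A2n_common.
Qed.

Lemma A2n_xi_unitary : xi * star xi = 1.
Proof.
by rewrite [star _]pstarE [LHS]pmulE; apply/pclsP; apply: sc_rel; exact: A2n_unitaryr.
Qed.

Lemma A2n_xi_central : central xi.
Proof.
by apply: pcls_ind => t; rewrite [LHS]pmulE [RHS]pmulE; apply/pclsP; apply: sc_rel; exact: A2n_central.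
Qed.

Definition A2n_xi : central_unitary (A2n q n) :=
  CentralUnitary A2n_xi_central A2n_xi_unitary.

Lemma A2n_zeta_star : star (zeta ord_max) = zeta ord_max * (A2n_xi : A2n q n).
Proof.
by rewrite [LHS]pstarE [RHS]pmulE; apply/pclsP; apply: sc_rel; exact: A2n_star.
Qed.

(** The generator is xi^* rather than xi because xi^* corresponds to v^2. *)
Lemma generates_A2n : generates (range zeta `|` [set cu_val (cu_star A2n_xi)])%classic.
Proof.
move=> S Ssub GS; have [_ _ _ SS] := Ssub.
apply: generates_pgen => // _ [[i|] _ <-]; first by apply: GS; left; exists i.
by rewrite -[pgen _ _]starK; apply: SS; apply: GS; right.
Qed.

Lemma A2n_lift (E : starAlgType C) (y : 'I_n.+1 -> E) (c : central_unitary E) :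
    sphere_family y -> star (y ord_max) = y ord_max * (c : E) ->
  exists h : A2n q n -> E,
    [/\ star_hom h, forall i, h (zeta i) = y i & h A2n_xi = c].
Proof.
case: c => c cC cU /= yF ys; pose g o := if o is Some i then y i else c.
have gR s t : A2n_rel q s t -> seval g s = seval g t.
  case=> [{}s {}t||||] //=.
  - exact: (sphere_familyP (fun i => Gen (Some i)) g).1.
  - by rewrite cU scst1.
  - by rewrite -cC cU scst1.
exists (plift g); split=> [|i|]; first exact: plift_hom gR.
- exact: plift_gen gR _.
- exact: plift_gen gR _.
Qed.

End SphereFamily.

Section U1.
Variable C : numClosedFieldType.
Local Notation v := (U1v C).

Lemma U1v_central : central v.
Proof.
(* The commutant of v alone is not visibly closed under the star, that of the
   pair v, v^* is. *)
pose S : set (OU1 C) := [set y | v * y = y * v /\ star v * y = y * star v]%classic.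
have Salg : star_subalgebra S.
  split=> [c|x y [vx sx] [vy sy]|x y [vx sx] [vy sy]|x [vx sx]].
  - by split; rewrite -scstC.
  - by split; rewrite mulrDl mulrDr ?vx ?vy ?sx ?sy.
  - by split; rewrite mulrA ?vx ?sx -!mulrA ?vy ?sy.
  - by split; rewrite -[v]starK -!starM ?starK ?vx ?sx.
have Sv y : range (pgen (@U1_rel C)) y -> S y.
  by case=> -[] _ <-; split=> //; rewrite [LHS]U1v_unitaryl [RHS]U1v_unitaryr.
by move=> y; have [] := generates_pgen Salg Sv y.
Qed.

Lemma tinr_U1v_unitary (A : starAlgType C) :
  tinr A (OU1 C) v * star (tinr A (OU1 C) v) = 1.
Proof. by rewrite tens_star tensM U1v_unitaryr star1 mulr1. Qed.

Definition tensU1v (A : starAlgType C) : central_unitary (A ⊗ OU1 C)%type :=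
  CentralUnitary (central_tinr (A := A) U1v_central) (tinr_U1v_unitary A).

Lemma U1_lift (E : starAlgType C) (w : central_unitary E) :
  exists h : OU1 C -> E, [/\ star_hom h, h v = w & forall b, central (h b)].
Proof.
case: w => w wC wU /=.
have wR s t : U1_rel s t -> seval (fun=> w) s = seval (fun=> w) t.
  by case; rewrite /= scst1 // -wC.
have hH := plift_hom wR; have hv : plift (fun=> w) v = w by exact: plift_gen wR _.
exists (plift (fun=> w)); split=> //; apply: generates_pgen.
  exact: star_subalgebra_preim hH (central_star_subalgebra _).
by move=> _ [[] _ <-]; rewrite /preimage /= hv.
Qed.

End U1.

(** * The prolongation *)

Section Prolongation.
Variables (C : numClosedFieldType) (A : starAlgType C).
Variable rho : A -> A ⊗ OZ2 C.
Hypothesis rhoH : star_hom rho.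
Local Notation P := (prolongation rho).
Local Notation v := (tinr A (OU1 C) (U1v C)).

Let lam h : OZ2 C ⊗ OU1 C := tmap (@pi2 C) idfun (U1comul h).
Let F1 := @tassoc C A (OZ2 C) (OU1 C) \o tmap rho (@idfun (OU1 C)).
Let F2 := tmap (@idfun A) lam.

Let lamH : star_hom lam.
Proof.
apply: star_hom_comp (U1comul_hom C).
exact: tmap_hom (pi2_hom C) (star_hom_id _).
Qed.

Let lam_v : lam (U1v C) = Z2u C ⊗ U1v C.
Proof.
rewrite /lam U1comul_v tmap_tens ?pi2_v //.
by apply: star_hom_linear; exact: pi2_hom.
Qed.

Let F1H : star_hom F1.
Proof.
by apply: star_hom_comp; [exact: tassoc_hom | exact: tmap_hom (star_hom_id _)].
Qed.

Let F2H : star_hom F2.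
Proof. exact: tmap_hom (star_hom_id _) lamH. Qed.

Let F1_tens a h : F1 (a ⊗ h) = tassoc (rho a ⊗ h).
Proof.
by rewrite /F1 /= tmap_tens //; apply: star_hom_linear => //; exact: star_hom_id.
Qed.

Let F2_tens a h : F2 (a ⊗ h) = a ⊗ lam h.
Proof.
by rewrite /F2 /= tmap_tens //; apply: star_hom_linear => //; exact: star_hom_id.
Qed.

Lemma prolongation_star_subalgebra : star_subalgebra P.
Proof. exact: star_subalgebra_equalizer F1H F2H. Qed.

Lemma prolongation_tens_v a : rho a = a ⊗ Z2u C -> P (a ⊗ U1v C).
Proof.
by move=> rho_a; rewrite /prolongation /cotensor /= [LHS]F1_tens rho_a
  [RHS]F2_tens lam_v tassoc_tens.
Qed.

Lemma prolongation_v2 : P (v * v).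
Proof.
rewrite tensM /prolongation /cotensor /= [LHS]F1_tens [RHS]F2_tens.
have [_ lamM _ _] := lamH.
by rewrite mulr1 (star_hom1 rhoH) tassoc_tens lamM lam_v tensM Z2u_sqr.
Qed.

(** The cotensor condition says that F1 and F2 agree. Applying the character
    Z2u |-> -1 to the middle factor gives endomorphisms of A ⊗ O(U(1)): F1 becomes
    the parity map of A when rho is a coaction, and F2 becomes v |-> -v, which is
    an involution. *)
Lemma prolongation_sign : exists s1 s2 : A ⊗ OU1 C -> A ⊗ OU1 C,
  [/\ star_hom s1, star_hom s2, forall x, P x -> s1 x = s2 x
    & [/\ s1 v = v, s2 v = - v & involutive s2]].
Proof.
have N1C : central (-1 : A ⊗ OU1 C) by move=> y; rewrite mulN1r mulrN1.
have starN1 : star (-1 : A ⊗ OU1 C) = -1.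
  apply: (addrI (star 1)); rewrite -starD subrr star0 star1 subrr //.
have sgnR s t : Z2_rel s t ->
    seval (fun=> -1 : A ⊗ OU1 C) s = seval (fun=> -1) t.
  by case; rewrite /= ?starN1 // mulN1r opprK scst1.
pose sgn : OZ2 C -> A ⊗ OU1 C := plift (fun=> -1).
have sgnH : star_hom sgn := plift_hom sgnR.
have sgnu : sgn (Z2u C) = -1 by exact: plift_gen sgnR _.
have sgnC : forall a, central (sgn a).
  apply: generates_pgen; first exact: star_subalgebra_preim (central_star_subalgebra _).
  by move=> _ [[] _ <-]; rewrite /preimage /= sgnu.
pose k := tpair sgn (tinr A (OU1 C)).
have kH : star_hom k by apply: tpair_hom (tinr_hom _ _) _ => // a b; exact: sgnC.
have kE a b : k (a ⊗ b) = sgn a * tinr A (OU1 C) b.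
  by apply: tpair_tens (tinr_hom _ _) _ _.
have klC a b : tinl A (OU1 C) a * k b = k b * tinl A (OU1 C) a.
  have [kD _ _ _] := kH.
  move: b; apply: tensor_ext => [x y|x y|b h]; rewrite ?kD ?mulrDl ?mulrDr //.
  by rewrite kE mulrA -sgnC -!mulrA -tens_inlr -tens_inrl.
pose kap := tpair (tinl A (OU1 C)) k.
have kapH : star_hom kap by exact: tpair_hom (tinl_hom _ _) kH klC.
have kapE a b : kap (a ⊗ b) = tinl A (OU1 C) a * k b.
  by apply: tpair_tens (tinl_hom _ _) kH _ _.
have s2v : kap (F2 v) = - v.
  by rewrite F2_tens lam_v kapE kE sgnu mulN1r (star_hom1 (tinl_hom _ _)) mul1r.
have s2l a : kap (F2 (tinl A (OU1 C) a)) = tinl A (OU1 C) a.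
  by rewrite F2_tens kapE (star_hom1 lamH) (star_hom1 kH) mulr1.
have s2H := star_hom_comp kapH F2H.
exists (kap \o F1), (kap \o F2); split=> //.
- exact: star_hom_comp kapH F1H.
- by move=> x xP; congr kap; exact: xP.
split=> //.
  rewrite /= F1_tens (star_hom1 rhoH) tassoc_tens kapE kE (star_hom1 sgnH).
  by rewrite !mul1r.
have genA : generates (setT : set A) by move=> S _ GS x; exact: GS.
apply: (star_hom_ext (generates_tens genA (@generates_pgen _ _ (@U1_rel C)))).
- exact: (star_hom_comp s2H s2H).
- exact: star_hom_id.
move=> x [[a _ <-]|[_ [[] _ <-] <-]] /=; first by rewrite !s2l.
rewrite s2v.
by have := star_homB 0 v s2H; rewrite !sub0r (star_hom0 s2H) sub0r /= s2v opprK.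
Qed.

End Prolongation.

Section ProlongationSphere.
Variables (C : numClosedFieldType) (q : C) (even : bool) (n : nat).
Local Notation A := (OS q even n).
Local Notation z := (@Sz C q even n).
Local Notation vu := (tensU1v A).
Local Notation v := (cu_val vu).

(* f is the map from D to P, and h the restriction to A of the inverse of the
   extension of f to D[w]. *)
Variables (D : starAlgType C) (d : 'I_n.+1 -> D) (u : central_unitary D).
Hypothesis genD : generates (range d `|` [set cu_val u])%classic.
Variables (f : D -> A ⊗ OU1 C) (h : A -> sqrt_ext u).
Hypotheses (fH : star_hom f) (fu : f u = v * v).
Hypotheses (fd : forall i, f (d i) = tinl A (OU1 C) (z i) * v).
Hypotheses (hH : star_hom h).
Hypothesis (hz : forall i, h (z i) = sqinc u (d i) * cu_val (cu_star (sqroot u))).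

(** The maps f and h extend to inverse isomorphisms F and g between D[w] and
    A ⊗ O(U(1)). So x in P is f a + f b v for some a and b, and f b v, which
    lies in P together with f b, has to vanish. *)
Lemma prolongation_isomorphic :
  star_isomorphic (prolongation (@coact C q even n)) D.
Proof.
have rhoH := coact_hom q even n.
have Psub := prolongation_star_subalgebra rhoH.
have [g2 [g2H g2v g2C]] := U1_lift (sqroot u).
pose g := tpair h g2.
have gC a b : h a * g2 b = g2 b * h a by rewrite g2C.
have gH : star_hom g by exact: tpair_hom gC.
have gl a : g (tinl A (OU1 C) a) = h a by exact: tpair_inl.
have gv : g v = cu_val (sqroot u) by rewrite [LHS]tpair_inr.
have [_ gM _ _] := gH.
have gfE : g \o f =1 sqinc u.
  apply: (star_hom_ext genD); [exact: star_hom_comp | exact: sqinc_hom |].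
  move=> _ [[i _ <-]|->] /=; last by rewrite fu gM gv sqgen_sqr.
  by rewrite fd gM gl gv hz -mulrA cu_unitaryl mulr1.
pose F := sqlift f vu : sqrt_ext u -> _.
have FH : star_hom F by exact: sqlift_hom.
have Fw : F (cu_val (sqroot u)) = v by exact: sqlift_gen.
have Finc a : F (sqinc u a) = f a by exact: sqlift_inc.
have [_ FM _ FS] := FH.
have FgE : F \o g =1 idfun.
  have genz := generates_tens (@generates_pgen _ _ (@qsphere_rel C q even n))
                              (@generates_pgen _ _ (@U1_rel C)).
  apply: (star_hom_ext genz); [exact: star_hom_comp | exact: star_hom_id |].
  move=> _ [[_ [i _ <-] <-]|[_ [[] _ <-] <-]] /=; last by rewrite [g _]gv Fw.
  by rewrite gl [h _]hz FM Finc FS Fw fd -mulrA cu_unitary mulr1.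
have fP a : prolongation (@coact C q even n) (f a).
  move: a; apply: genD; first exact: star_subalgebra_preim fH Psub.
  move=> _ [[i _ <-]|->]; rewrite /preimage /=.
    by rewrite fd -tens_inlr; apply: prolongation_tens_v => //; exact: coact_z.
  by rewrite fu; exact: prolongation_v2.
have finj : injective f.
  by move=> a b fab; have := gfE a; rewrite /= fab [g _]gfE => -[].
exists f; split=> //; apply/seteqP; split=> [_ [a _ <-]|x xP]; first exact: fP.
have [s1 [s2 [s1H s2H s12 [s1v s2v s2K]]]] := prolongation_sign rhoH.
have [s1D s1M _ _] := s1H; have [s2D s2M _ _] := s2H.
case gx : (g x) => [a b].
have xE : x = f a + f b * v by have := FgE x; rewrite /= gx.
exists a => //.
suff fb0 : f b = 0 by rewrite xE fb0 mul0r addr0.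
(* s1 and s2 agree on x, f a and f b, but s1 v = v and s2 v = -v: so
   2 s2 (f b) v = 0. *)
have : s1 x = s2 x by exact: s12.
rewrite xE s1D s2D s1M s2M s1v s2v !s12 //.
move/addrI; rewrite mulrN => /eqP; rewrite -subr_eq0 opprK => /eqP sv0.
have s20 : s2 (f b) = 0.
  have : (2^-1)%:S * (s2 (f b) * v + s2 (f b) * v) * star v = 0.
    by rewrite sv0 mulr0 mul0r.
  have halves : 2^-1 + 2^-1 = 1 :> C by rewrite [RHS]splitr !mul1r.
  by rewrite mulrDr -mulrDl -scstD halves scst1 mul1r -mulrA cu_unitary mulr1.
by rewrite -[LHS]s2K s20 star_hom0.
Qed.

End ProlongationSphere.

Section Isomorphisms.
Variables (C : numClosedFieldType) (q : C) (n : nat).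

(** Here D is the tensor product itself, with the z_i ⊗ 1 as the d_i and v as its
    own central unitary: the embedding into P multiplies z_i by v and squares v. *)
Lemma prolongation_odd_isomorphic :
  star_isomorphic (prolongation (@coact_odd C q n)) (OSodd q n ⊗ OU1 C)%type.
Proof.
pose A := OSodd q n; pose il := tinl A (OU1 C); pose v := tensU1v A.
have noself (P : Prop) : false -> P by [].
have zF := sphere_family_hom (tinl_hom A (OU1 C)) (@OS_sphere_family C q n false).
have [f1 f1H f1z] := OS_lift (sphere_family_twist v zF) (noself _).
have [f2 [f2H f2v f2C]] := U1_lift (cu_mul v v).
have f12C a b : f1 a * f2 b = f2 b * f1 a by rewrite f2C.
have [h hH hz] := OS_lift (sphere_family_twist (cu_star (sqroot v))
  (sphere_family_hom (sqinc_hom v) zF)) (noself _).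
apply: (@prolongation_isomorphic _ _ _ _ _ (il \o @Sz C q false n) v _ (tpair f1 f2) h) => //.
- move=> S Ssub GS.
  apply: (generates_tens (@generates_pgen _ _ _) (@generates_pgen _ _ _)) => // x.
  case=> [[_ [i _ <-] <-]|[_ [[] _ <-] <-]]; apply: GS; last by right.
  by left; exists i.
- exact: tpair_hom.
- by rewrite /= tpair_inr.
- by move=> i; rewrite /= tpair_inl // f1z.
Qed.

(** The embedding sends zeta_i to z_i v and xi to v^-2; both sides of
    zeta_n^* = zeta_n xi then become z_n v^-1. *)
Lemma prolongation_even_isomorphic :
  star_isomorphic (prolongation (@coact_even C q n)) (A2n q n).
Proof.
pose A := OSeven q n; pose v := tensU1v A; pose x := cu_star (A2n_xi q n).
have zF := sphere_family_hom (tinl_hom A (OU1 C)) (@OS_sphere_family C q n true).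
have [|f [fH fz fxi]] :=
    A2n_lift (c := cu_star (cu_mul v v)) (sphere_family_twist v zF).
  rewrite /= !starM -[in RHS]mulrA (mulrA (cu_val v)) cu_unitary mul1r.
  rewrite -[RHS](cu_central (cu_star v)); congr (_ * _).
  by rewrite tens_star OS_self_adjoint // star1.
have zetaF := sphere_family_hom (sqinc_hom x) (@A2n_sphere_family C q n).
have [|h hH hz] :=
    OS_lift (even := true) (sphere_family_twist (cu_star (sqroot x)) zetaF).
  (* With w the adjoined root, xi = w^-2, so that
     (zeta_n w^-1)^* = w zeta_n w^-2. *)
  move=> _; have [_ jM _ jS] := sqinc_hom x.
  rewrite starM starK /= -jS A2n_zeta_star jM.
  have -> : sqinc x (A2n_xi q n) = star (sqgen x) * star (sqgen x).
    by rewrite -starM sqgen_sqr -jS /= starK.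
  rewrite (cu_central (sqroot x)) -!mulrA; congr (_ * _).
  by rewrite [_ * sqgen _](cu_unitaryl (sqroot x)) mulr1.
apply: (@prolongation_isomorphic _ _ _ _ _ (@A2n_zeta C q n) x _ f h) => //.
- exact: generates_A2n.
- by have [_ _ _ fS] := fH; rewrite /= fS fxi starK.
Qed.

End Isomorphisms.

Theorem proposition5p2 (R : realType) (q : R) (hq0 : 0 < q) (hq1 : q < 1) :
  (forall n : nat, (1 <= n)%N ->
     star_subalgebra (prolongation (@coact_odd R[i] q%:C n)) /\
     star_isomorphic (prolongation (@coact_odd R[i] q%:C n))
       (OSodd q%:C n ⊗ OU1 R[i])%type) /\
  (forall n : nat, (1 < n)%N ->
     star_subalgebra (prolongation (@coact_even R[i] q%:C n)) /\
     star_isomorphic (prolongation (@coact_even R[i] q%:C n)) (A2n q%:C n)).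
Proof.
split=> n _; split.
- exact: prolongation_star_subalgebra (coact_hom _ _ _).
- exact: prolongation_odd_isomorphic.
- exact: prolongation_star_subalgebra (coact_hom _ _ _).
- exact: prolongation_even_isomorphic.
Qed.
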